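(* The semi-dual $\mathcal J$ is generalized self-concordant: with $M=\frac{2+3\alpha}{\varepsilon}$ for the KL source and $M=\frac6\varepsilon$ for the $\chi^2$ source, for every $\mathbf g\in\mathbb R^n$ and every direction $\mathbf h\in\mathbb R^n$, $$\big|\nabla^3\mathcal J(\mathbf g)[\mathbf h,\mathbf h,\mathbf h]\big|\le M\,\|\mathbf h\|_\infty\,\langle\mathbf h,\nabla^2\mathcal J(\mathbf g)\mathbf h\rangle .$$
   Context: $\mathcal X,\mathcal Y$ are Polish spaces, $\mu$ is a finite nonnegative measure on $\mathcal X$, $\nu=\sum_{j=1}^n\beta_j\delta_{y_j}$ with $y_1,\dots,y_n\in\mathcal Y$, $\beta_j>0$, and $b/n\le\beta_j\le B/n$ for constants $0<b\le B$. The cost $c:\mathcal X\times\mathcal Y\to[0,\infty)$ is continuous, $\varepsilon,\rho_1,\rho_2>0$, and $\alpha=\frac{\varepsilon}{\varepsilon+\rho_1}$. For $x\in\mathcal X$, $\mathbf g\in\mathbb R^n$: $B_j(x,\mathbf g)=\beta_j\exp\big(\tfrac{g_j-c(x,y_j)}{\varepsilon}\big)$ and $Z(x,\mathbf g)=\sum_{j=1}^nB_j(x,\mathbf g)$. The semi-dual objective of entropic unbalanced optimal transport (with $\chi^2$ target penalty) is $$\mathcal J(\mathbf g)=\mathcal J_{\mathrm{trans}}(\mathbf g)+\sum_{j=1}^n\beta_j\Big(\frac{g_j^2}{2\rho_2}-g_j\Big),$$ where: - KL source: $\mathcal J_{\mathrm{trans}}(\mathbf g)=(\rho_1+\varepsilon)\int_{\mathcal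 X}Z(x,\mathbf g)^\alpha d\mu(x)$; - $\chi^2$ source: $\mathcal J_{\mathrm{trans}}(\mathbf g)=\frac{\varepsilon^2}{\rho_1}\int_{\mathcal X}\big(W(U(x,\mathbf g))+\tfrac12W(U(x,\mathbf g))^2\big)d\mu(x)$, with $U(x,\mathbf g)=\frac{\rho_1}{\varepsilon}e^{\rho_1/\varepsilon}Z(x,\mathbf g)$ and $W$ the Lambert function (inverse of $z\mapsto ze^z$ on $[0,\infty)$). $\nabla^3\mathcal J(\mathbf g)[\mathbf h,\mathbf h,\mathbf h]$ denotes the third directional derivative $\frac{d^3}{dt^3}\mathcal J(\mathbf g+t\mathbf h)|_{t=0}$. *)

(* Defs.v *)
From mathcomp Require Export all_boot all_order all_algebra.
From mathcomp Require Export all_classical all_reals all_analysis.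
Export Order.TTheory GRing.Theory Num.Theory.
Export numFieldNormedType.Exports.

Set Implicit Arguments.
Unset Strict Implicit.
Unset Printing Implicit Defensive.

Local Open Scope classical_set_scope.
Local Open Scope ring_scope.

Definition polish (R : realType) (T : topologicalType) : Prop :=
  (exists2 D : set T, countable D & dense D) /\
  exists d : T -> T -> R,
    [/\ forall x y, d x y = 0 <-> x = y,
        forall x y, d x y = d y x,
        forall x y z, d x z <= d x y + d y z,
        forall (x : T) (A : set T), nbhs x A <-> (
          exists2 e : R, 0 < e & [set y | d x y < e] `<=` A) &
        forall u : nat -> T,
          (forall e : R, 0 < e -> exists N : nat, forall m n : nat,
             (N <= m)%N -> (N <= n)%N -> d (u m) (u n) < e) ->
          exists l : T, u @ \oo --> l].

Notation borel T := (g_sigma_algebraType (@open T)).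

Definition lambertW (R : realType) : R -> R :=
  'pinv_(fun=> 0) [set z : R | 0 <= z] (fun z => z * expR z).

(* The discrete measure nu = sum_j beta_j delta_(y_j) enters only through its
   weights beta and atoms y, which need not be distinct. *)
Section semi_dual.
Context {R : realType} {X : ptopologicalType} {Y : topologicalType} {n : nat}.
Variables (mu : {finite_measure set (borel X) -> \bar R}).
Variables (beta : 'I_n -> R) (y : 'I_n -> Y) (c : X -> Y -> R).
Variables (eps rho1 rho2 : R).

Definition B_ (j : 'I_n) (x : X) (g : 'rV[R]_n) : R :=
  beta j * expR ((g ord0 j - c x (y j)) / eps).

Definition Z_ (x : X) (g : 'rV[R]_n) : R := \sum_(j < n) B_ j x g.

Definition alpha : R := eps / (eps + rho1).

Definition Jtrans_KL (g : 'rV[R]_n) : R :=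
  (rho1 + eps) * \int[mu]_x (Z_ x g `^ alpha).

Definition U_ (x : X) (g : 'rV[R]_n) : R :=
  rho1 / eps * expR (rho1 / eps) * Z_ x g.

Definition Jtrans_chi2 (g : 'rV[R]_n) : R :=
  eps ^+ 2 / rho1 *
  \int[mu]_x (lambertW (U_ x g) + 2^-1 * lambertW (U_ x g) ^+ 2).

Definition target_penalty (g : 'rV[R]_n) : R :=
  \sum_(j < n) beta j * (g ord0 j ^+ 2 / (2 * rho2) - g ord0 j).

Definition semi_dual_KL (g : 'rV[R]_n) : R := Jtrans_KL g + target_penalty g.

Definition semi_dual_chi2 (g : 'rV[R]_n) : R :=
  Jtrans_chi2 g + target_penalty g.

End semi_dual.

Section self_concordance.
Context {R : realType} {n : nat}.
Implicit Types (J : 'rV[R]_n -> R) (g h : 'rV[R]_n).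

(* J is of class C^3: this makes the derivatives below genuine, since 'D_v and
   derive1n are total operators. *)
Definition class_C3 J : Prop := forall u v w g : 'rV[R]_n,
  [/\ derivable J g u,
      derivable ('D_u J) g v,
      derivable ('D_v ('D_u J)) g w &
      {for g, continuous ('D_w ('D_v ('D_u J)))}].

Definition third_directional_derivative J g h : R :=
  derive1n 3 (fun t : R => J (g + t *: h)) 0.

Definition hessian J g : 'M[R]_n :=
  \matrix_(i < n, j < n)
    'D_(delta_mx ord0 i) ('D_(delta_mx ord0 j) J) g.

(* On 'rV[R]_n the norm `|h| is the sup norm. *)
Definition generalized_self_concordant (M : R) J : Prop :=
  class_C3 J /\
  forall g h, `|third_directional_derivative J g h| <=
    M * `|h| * (h *m hessian J g *m h^T) ord0 ord0.

End self_concordance.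

(* Main.v *)
Require Import Defs.
From mathcomp Require Import ring lra measurable_realfun.

(** Both semi-duals have the form
      J g = C * (integral over x of P (Z x g)) + quadratic penalty,
    where Z is a sum of exponentials of affine functions of g. Writing
    s = ln Z, the s-derivatives of P(e^s) give a chain P0 = P, P1, P2, P3
    (each P_(i+1) is z |-> z * P_i' z), while the derivatives of s along h are
    1/eps, 1/eps^2, 1/eps^3 times the mean m, the variance v and the third
    central moment k of h under the Gibbs weights q_j = B_j / Z. Hence the
    integrand has second and third derivatives along h
      (P2 m^2 + P1 v) / eps^2   and   (P3 m^3 + 3 P2 m v + P1 k) / eps^3.
    With H the sup norm of h one has |m| <= H and |k| <= 2 H v, so the third
    derivative is at most (M / eps) H times the second as soon as
    |P3| <= M P2 and 3 P2 + 2 P1 <= M P1 ([third_order_bound]).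
    - KL source: P_i = alpha^i z^alpha, which allows M = 2 + 3 alpha.
    - chi^2 source: with w = W (kappa z), P1 = w, P2 = w / (1 + w) and
      P3 = w / (1 + w)^3, so that |P3| <= P2 <= P1 and M = 6 is allowed.
    The penalty has no third derivative and a nonnegative second one, so it only
    helps ([gsc_of_profile]).

    The analytic part is that J is of class C^3 and that its derivatives are
    integrals of the derivatives of the integrand. For this one works with
    families f x g that are continuous in x, bounded for g in a ball uniformly
    in x, and whose partial derivatives in g are of the same kind ([tame]). Such
    families form an algebra, and the families needed here, q_j, Z^alpha,
    W (kappa Z) and 1 / (1 + W (kappa Z)), belong to it because the partial
    derivatives of each are polynomials in these same families. As mu is finite,
    a uniform bound is an integrable bound, so a tame family can be
    differentiated under the integral and its integral is tame again
    ([tame_Rintegral]). Continuity in g needs no separate argument: bounded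
    partial derivatives make a function locally Lipschitz
    ([tame_continuous]). *)

Set Implicit Arguments.
Unset Strict Implicit.
Unset Printing Implicit Defensive.

Local Open Scope classical_set_scope.
Local Open Scope ring_scope.

(** * Directional derivatives *)

Section directional_derivatives.
Context {R : realType} {V : normedModType R}.
Implicit Types (F G : V -> R) (g u : V).

(** Transfers one-variable results (chain rule, mean value theorem,
    differentiation under the integral) to directional derivatives. *)
Lemma is_derive_line F g u (t l : R) :
  is_derive (g + t *: u) u F l <-> is_derive t 1 (fun s => F (g + s *: u)) l.
Proof.
have E : (fun h => h^-1 *: ((F \o shift (g + t *: u)) (h *: u) - F (g + t *: u)))
  = (fun h => h^-1 *: (((fun s => F (g + s *: u)) \o shift t) (h *: 1)
        - F (g + t *: u))).
  apply/funext => h /=; congr (_ *: (F _ - _)).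
  by rewrite [h *: 1]mulr1 scalerDl addrCA.
by split=> -[d e]; split; move: d e; rewrite /derivable /derive E.
Qed.

Lemma is_derive_comp_dir (phi : R -> R) F g u (l m : R) :
  is_derive (F g) 1 phi m -> is_derive g u F l ->
  is_derive g u (fun v => phi (F v)) (m * l).
Proof.
move=> hphi hF.
have {}hF : is_derive (0 : R) 1 (fun s => F (g + s *: u)) l.
  by apply/is_derive_line; rewrite scale0r addr0.
have {}hphi : is_derive (F (g + (0 : R) *: u)) 1 phi m.
  by rewrite scale0r addr0.
have /(is_derive_line (fun v => phi (F v))) := is_derive1_comp hphi hF.
by rewrite scale0r addr0.
Qed.

Lemma is_derive_mul F G g u (l m : R) :
  is_derive g u F l -> is_derive g u G m ->
  is_derive g u (fun v => F v * G v) (F g * m + G g * l).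
Proof. by move=> hF hG; exact: is_deriveM. Qed.

Lemma is_derive_add F G g u (l m : R) :
  is_derive g u F l -> is_derive g u G m ->
  is_derive g u (fun v => F v + G v) (l + m).
Proof. by move=> hF hG; exact: is_deriveD. Qed.

Lemma is_derive_scale (k : R) F g u (l : R) :
  is_derive g u F l -> is_derive g u (fun v => k * F v) (k * l).
Proof. by move=> hF; exact: (is_deriveZ k). Qed.

Lemma is_derive_bigsum n (F : 'I_n -> V -> R) g u (l : 'I_n -> R) :
  (forall i, is_derive g u (F i) (l i)) ->
  is_derive g u (fun v => \sum_i F i v) (\sum_i l i).
Proof.
move=> hF; have := is_derive_sum hF.
by congr is_derive; apply/funext => v; rewrite fct_sumE.
Qed.

Lemma is_derive_unique F g u (l m : R) :
  is_derive g u F l -> is_derive g u F m -> l = m.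
Proof. by move=> [_ <-] [_ <-]. Qed.

End directional_derivatives.

Lemma is_derive_coord {R : realType} n (j : 'I_n) (g u : 'rV[R]_n) :
  is_derive g u (fun v : 'rV[R]_n => v ord0 j) (u ord0 j).
Proof.
have : is_derive (0 : R) 1 (fun s : R => (g + s *: u) ord0 j) (u ord0 j).
  have -> : (fun s : R => (g + s *: u) ord0 j) =
      (cst (g ord0 j) + (u ord0 j) \*: id).
    by apply/funext => s; rewrite !mxE mulrC.
  by apply: is_derive_eq; rewrite add0r /GRing.scale /= mulr1.
by move/(is_derive_line (fun v : 'rV[R]_n => v ord0 j)); rewrite scale0r addr0.
Qed.

Lemma coord_le_norm {R : realType} n (u : 'rV[R]_n) j : `|u ord0 j| <= `|u|.
Proof.
rewrite [leRHS]/Num.Def.normr/= mx_normrE.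
exact: (le_bigmax _ _ (ord0, j)).
Qed.

(** * Uniformly differentiable families *)

Section tame.
Context {R : realType} {X : ptopologicalType} {n : nat}.
Local Notation V := 'rV[R]_n.
Implicit Types (f : X -> V -> R) (k : nat).

Definition tame0 f : Prop :=
  (forall g, continuous (f ^~ g)) /\
  (forall K : R, exists C : R, forall x (g : V), `|g| <= K -> `|f x g| <= C).

(** C^k regularity in g, recorded through partial derivatives: the bounds of
    [tame0] on them supply both the domination for differentiating under the
    integral and the continuity in g. Asking for one family of partial
    derivatives that serves every direction u makes the derivative linear in u,
    which relates directional derivatives to the Hessian matrix. *)
Fixpoint tame k f : Prop :=
  if k is k'.+1 then
    tame0 f /\ exists2 df : 'I_n -> X -> V -> R,
      forall j, tame k' (df j) &
      forall x (g u : V), is_derive g u (f x) (\sum_j u ord0 j * df j x g)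
  else tame0 f.

Lemma tame_tame0 k f : tame k f -> tame0 f.
Proof. by case: k => [|k] // []. Qed.

Lemma tame_partials k f : tame k.+1 f -> exists2 df : 'I_n -> X -> V -> R,
  forall j, tame k (df j) &
  forall x (g u : V), is_derive g u (f x) (\sum_j u ord0 j * df j x g).
Proof. by case. Qed.

Lemma tameW k f : tame k.+1 f -> tame k f.
Proof.
elim: k f => [|k IH] f [f0 [df df_tame dfE]] //.
by split=> //; exists df => // j; exact: IH.
Qed.

Lemma tame_le k l f : (k <= l)%N -> tame l f -> tame k f.
Proof.
move=> kl; rewrite -(subnK kl).
by elim: (l - k)%N => [//|m IH] /tameW.
Qed.

Lemma tame_ext k f1 f2 : (forall x g, f1 x g = f2 x g) -> tame k f1 -> tame k f2.
Proof.
move=> e; suff -> : f1 = f2 by [].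
by apply/funext => x; apply/funext => g; rewrite e.
Qed.

Lemma tame_cst k (a : R) : tame k (fun _ _ => a).
Proof.
have a0 (b : R) : tame0 (fun _ _ => b).
  by split=> [?|K]; [exact: cst_continuous | exists `|b|].
elim: k a => [|k IH] a; first exact: a0.
split; first exact: a0.
exists (fun _ _ _ => 0) => // x g u.
rewrite big1 => [|j _]; last by rewrite mulr0.
exact: is_derive_cst.
Qed.

Lemma tame_coord k j : tame k (fun _ g => g ord0 j).
Proof.
have t0 : tame0 (fun (_ : X) (g : V) => g ord0 j).
  split=> [? ?|K]; first exact: cst_continuous.
  by exists K => x g; apply: le_trans; exact: coord_le_norm.
case: k => [//|k]; split=> //.
exists (fun i _ _ => (i == j)%:R) => [i|x g u]; first exact: tame_cst.
rewrite (bigD1 j) //= eqxx mulr1 big1 ?addr0; last first.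
  by move=> i /negbTE ->; rewrite mulr0.
exact: is_derive_coord.
Qed.

Lemma tameD k f1 f2 : tame k f1 -> tame k f2 ->
  tame k (fun x g => f1 x g + f2 x g).
Proof.
have D f f' : tame0 f -> tame0 f' -> tame0 (fun x g => f x g + f' x g).
  move=> [c1 b1] [c2 b2]; split=> [g x|K].
    by apply: cvgD; [exact: c1 | exact: c2].
  have [C1 h1] := b1 K; have [C2 h2] := b2 K.
  exists (C1 + C2) => x g gK.
  by rewrite (le_trans (ler_normD _ _))// lerD// ?h1 ?h2.
elim: k f1 f2 => [|k IH] f1 f2; first exact: D.
move=> [t1 [d1 d1_tame e1]] [t2 [d2 d2_tame e2]]; split; first exact: D.
exists (fun j x g => d1 j x g + d2 j x g) => [j|x g u].
  exact: (IH _ _ (d1_tame j) (d2_tame j)).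
under eq_bigr do rewrite mulrDr.
by rewrite big_split; apply: is_derive_add.
Qed.

Lemma tameM k f1 f2 : tame k f1 -> tame k f2 ->
  tame k (fun x g => f1 x g * f2 x g).
Proof.
have M f f' : tame0 f -> tame0 f' -> tame0 (fun x g => f x g * f' x g).
  move=> [c1 b1] [c2 b2]; split=> [g x|K].
    by apply: cvgM; [exact: c1 | exact: c2].
  have [C1 h1] := b1 K; have [C2 h2] := b2 K.
  by exists (C1 * C2) => x g gK; rewrite normrM ler_pM// ?h1 ?h2.
elim: k f1 f2 => [|k IH] f1 f2; first exact: M.
move=> t1 t2; have [t1' t2'] := (tameW t1, tameW t2).
case: t1 t2 => [t1 [d1 d1_tame e1]] [t2 [d2 d2_tame e2]].
split; first exact: M.
exists (fun j x g => f1 x g * d2 j x g + f2 x g * d1 j x g) => [j|x g u].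
  exact: tameD (IH _ _ t1' (d2_tame j)) (IH _ _ t2' (d1_tame j)).
under eq_bigr => j _ do rewrite mulrDr mulrCA (mulrCA (u ord0 j)).
by rewrite big_split -!mulr_sumr; apply: is_derive_mul.
Qed.

Lemma tameZ k (a : R) f : tame k f -> tame k (fun x g => a * f x g).
Proof. by apply: tameM; exact: tame_cst. Qed.

Lemma tame_sum k m (f : 'I_m -> X -> V -> R) : (forall i, tame k (f i)) ->
  tame k (fun x g => \sum_i f i x g).
Proof.
move=> tf; elim: m f tf => [|m IH] f tf.
  by apply: tame_ext (tame_cst k 0) => x g; rewrite big_ord0.
have := tameD (tf ord0) (IH (fun i => f (lift ord0 i)) (fun i => tf _)).
by apply: tame_ext => x g; rewrite big_ord_recl.
Qed.

(** Whatever formula is found for the derivative along u, uniqueness of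
    derivatives makes it tame: explicit second and third derivatives inherit
    their regularity from f. *)
Lemma tame_dir k f f1 u : tame k.+1 f ->
  (forall x g, is_derive g u (f x) (f1 x g)) -> tame k f1.
Proof.
move=> /tame_partials[df df_tame dfE] f1E.
apply: (@tame_ext _ (fun x g => \sum_j u ord0 j * df j x g)).
  by move=> x g; apply: is_derive_unique (dfE x g u) (f1E x g).
by apply: tame_sum => j; exact: tameZ (df_tame j).
Qed.

(** By the mean value theorem on segments issued from g, f is Lipschitz near g
    with the sum of the bounds on the partial derivatives as constant. *)
Lemma tame_continuous f x : tame 1 f -> continuous (f x).
Proof.
move=> /tame_partials[df df_tame dfE] g.
have [C hC] : exists C, forall v, `|v| <= `|g| + 1 ->
    \sum_j `|df j x v| <= C.
  have [C hC] := choice (fun j => (tame_tame0 (df_tame j)).2 (`|g| + 1)).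
  by exists (\sum_j C j) => v hv; apply: ler_sum => j _; exact: hC.
have C0 : 0 <= C.
  by rewrite (le_trans _ (hC g _)) ?lerDl// sumr_ge0.
have lip u : `|u| <= 1 -> `|f x (g + u) - f x g| <= C * `|u|.
  move=> u1.
  have D (s : R) : is_derive s 1 (fun t => f x (g + t *: u))
      (\sum_j u ord0 j * df j x (g + s *: u)).
    exact: (is_derive_line (f x) g u s _).1 (dfE x (g + s *: u) u).
  have [|s s01] := @MVT_segment _ (fun t => f x (g + t *: u)) _ 0 1 ler01
    (fun s _ => D s).
    apply: derivable_within_continuous => s _; by case: (D s).
  rewrite scale1r scale0r addr0 subr0 mulr1 => ->.
  apply: le_trans (ler_norm_sum _ _ _) _.
  have hs : `|g + s *: u| <= `|g| + 1.
    apply: le_trans (ler_normD _ _) _; rewrite lerD2l normrZ.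
    move: s01; rewrite in_itv /= => /andP[s0 s1].
    by rewrite ger0_norm // -[leRHS]mul1r ler_pM.
  apply: le_trans (ler_wpM2r (normr_ge0 u) (hC _ hs)).
  rewrite mulr_suml; apply: ler_sum => j _.
  by rewrite normrM mulrC ler_wpM2l //; exact: coord_le_norm.
apply/(@cvgrPdist_le _ _ _ (nbhs (g : V)) (nbhs_filter _)) => e e0.
have C1 : 0 < C + 1 by rewrite ltr_wpDl.
apply/nbhs_ballP; exists (Num.min 1 (e / (C + 1))) => /=.
  by rewrite lt_min ltr01 divr_gt0.
move=> v; rewrite -ball_normE /= distrC lt_min => /andP[v1 ve].
have -> : v = g + (v - g) by rewrite addrC subrK.
rewrite distrC; apply: le_trans (lip _ (ltW v1)) _.
rewrite (@le_trans _ _ ((C + 1) * `|v - g|)) // ?ler_wpM2r ?lerDl //.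
by rewrite mulrC -ler_pdivlMr // ltW.
Qed.

End tame.

(** * Integrals of tame families *)

Lemma continuous_borel_measurable {R : realType} {X : ptopologicalType}
  (f : X -> R) : continuous f -> measurable_fun [set: borel X] f.
Proof.
move=> /continuousP cf; apply: (measurability _ (RGenOpens.measurableE R)).
move=> _ [_ [a [b ->] <-]]; rewrite setTI.
by apply: sub_sigma_algebra; apply: cf; exact: interval_open.
Qed.

Section integral.
Context {R : realType} {X : ptopologicalType} {n : nat}.
Variable mu : {finite_measure set (borel X) -> \bar R}.
Local Notation V := 'rV[R]_n.
Implicit Types (f : X -> V -> R) (k : nat).

Lemma bounded_continuous_integrable (f : X -> R) (C : R) : continuous f ->
  (forall x, `|f x| <= C) -> mu.-integrable [set: borel X] (EFin \o f).
Proof.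
move=> cf fC; apply: measurable_bounded_integrable => //.
- exact: fin_num_fun_lty.
- exact: continuous_borel_measurable.
- exists C; split=> [|M CM x _]; first exact: num_real.
  exact: le_trans (fC x) (ltW CM).
Qed.

Lemma tame_integrable k f g : tame k f ->
  mu.-integrable [set: borel X] (EFin \o f ^~ g).
Proof.
move=> /tame_tame0[fc fb]; have [C hC] := fb `|g|.
by apply: (@bounded_continuous_integrable (f ^~ g) C) => // x; exact: hC.
Qed.

Lemma tame0_Rintegral f : tame0 f -> tame0 (fun (_ : X) g => \int[mu]_x f x g).
Proof.
move=> f0; split=> [? ?|K]; first exact: cst_continuous.
have [C hC] := f0.2 K.
exists (C * fine (mu setT)) => _ g gK.
apply: le_trans (le_normr_Rintegral measurableT (tame_integrable (k := 0) g f0)) _.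
rewrite -(Rintegral_cst mu measurableT) le_Rintegral//.
- by apply/integrable_norm; exact: (tame_integrable (k := 0)).
- by apply: (@bounded_continuous_integrable (fun=> C) `|C|) => // x; exact: cst_continuous.
- by move=> x _; exact: hC.
Qed.

(** Dominated differentiation along the line t |-> g + t u for |t| < 1: there
    the norm of the argument is at most |g| + |u|, so f1 is bounded by a
    constant, which is integrable because mu is finite. *)
Lemma is_derive_Rintegral f f1 u : tame0 f -> tame0 f1 ->
  (forall x g, is_derive g u (f x) (f1 x g)) ->
  forall g, is_derive g u (fun v => \int[mu]_x f x v) (\int[mu]_x f1 x g).
Proof.
move=> f0 f10 f1E g.
pose phi (t : R) (x : borel X) := f x (g + t *: u).
have [C hC] := f10.2 (`|g| + `|u|).
have phiE (t : R) x : is_derive t 1 (phi ^~ x) (f1 x (g + t *: u)).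
  exact: (is_derive_line (f x) g u t _).1 (f1E x (g + t *: u)).
have d1E (t : R) x : partial1of2 phi t x = f1 x (g + t *: u).
  by rewrite partial1of2E; case: (phiE t x).
have I0 : `](-1), 1[%classic (0 : R) by rewrite /= in_itv /= ltrN10 ltr01.
have intphi (t : R) : `](-1), 1[%classic t -> mu.-integrable setT (EFin \o phi t).
  by move=> _; exact: (tame_integrable (k := 0) _ f0).
have dphi (t : R) (x : borel X) : `](-1), 1[%classic t -> setT x ->
    derivable (phi ^~ x) t 1.
  by move=> _ _; case: (phiE t x).
have intC : mu.-integrable [set: borel X] (EFin \o (fun=> `|C|)).
  by apply: (@bounded_continuous_integrable (fun=> `|C|) `|C|) => // x;
    [exact: cst_continuous | rewrite normr_id].
have domC (t : R) (x : borel X) : `](-1), 1[%classic t -> setT x ->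
    `|partial1of2 phi t x| <= `|C|.
  rewrite /= in_itv /= => tI _; rewrite d1E (le_trans _ (ler_norm C))// hC//.
  rewrite (le_trans (ler_normD _ _))// lerD2l normrZ -[leRHS]mul1r ler_wpM2r//.
  by rewrite ler_norml !ltW //; case/andP: tI.
have D := derivable_under_integral measurableT I0 intphi dphi
  (fun x => normr_ge0 C) intC domC.
have E := differentiation_under_integral measurableT I0 intphi dphi
  (fun x => normr_ge0 C) intC domC.
have : is_derive (0 : R) 1 (fun t => \int[mu]_x f x (g + t *: u)) (\int[mu]_x f1 x g).
  split; first exact: D.
  rewrite -derive1E [LHS]E.
  by apply: eq_Rintegral => x _; rewrite d1E scale0r addr0.
by move/(is_derive_line (fun v => \int[mu]_x f x v)); rewrite scale0r addr0.
Qed.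

Lemma Rintegral_tame_sum m (a : 'I_m -> R) (f : 'I_m -> X -> V -> R) g :
  (forall i, tame0 (f i)) ->
  \int[mu]_x (\sum_i a i * f i x g) = \sum_i a i * \int[mu]_x f i x g.
Proof.
move=> f0; elim: m a f f0 => [|m IH] a f f0.
  rewrite big_ord0; under eq_Rintegral do rewrite big_ord0.
  by rewrite (Rintegral_cst mu measurableT) mul0r.
rewrite big_ord_recl -(IH (fun i => a (lift ord0 i)) (fun i => f (lift ord0 i)))//.
under eq_Rintegral do rewrite big_ord_recl.
rewrite RintegralD//.
- by rewrite RintegralZl//; exact: (tame_integrable (k := 0) _ (f0 ord0)).
- exact: (tame_integrable (k := 0) g (tameZ (k := 0) (a ord0) (f0 ord0))).
- apply: (tame_integrable (k := 0) g (f := fun x g =>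
    \sum_(i < m) a (lift ord0 i) * f (lift ord0 i) x g)).
  by apply: (tame_sum (k := 0)) => i; exact: (tameZ (k := 0) _ (f0 _)).
Qed.

Lemma tame_Rintegral k f : tame k f ->
  tame k (fun (_ : X) g => \int[mu]_x f x g).
Proof.
elim: k f => [|k IH] f; first exact: tame0_Rintegral.
move=> [f0 [df df_tame dfE]]; split; first exact: tame0_Rintegral.
exists (fun j _ g => \int[mu]_x df j x g) => [j|x g u]; first exact: IH (df_tame j).
have df0 j : tame0 (df j) := tame_tame0 (df_tame j).
rewrite -Rintegral_tame_sum //.
apply: is_derive_Rintegral => //.
by apply: (tame_sum (k := 0)) => j; exact: (tameZ (k := 0) _ (df0 j)).
Qed.

End integral.

(** * Regularity and iterated directional derivatives *)

Section regularity.
Context {R : realType} {X : ptopologicalType} {n : nat}.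
Local Notation V := 'rV[R]_n.
Implicit Types (J : V -> R) (k : nat).

(** A function of g alone, seen as a family that is constant in x: the algebra
    of tame families then applies unchanged to integrals and to the penalty. *)
Definition tame1 k J := tame k (fun _ : X => J).

Lemma tame1_derivable k J (g u : V) : tame1 k.+1 J -> derivable J g u.
Proof. by move=> /tame_partials[dJ _ dJE]; case: (dJE point g u). Qed.

Lemma tame1_derive k J u : tame1 k.+1 J -> tame1 k ('D_u J).
Proof.
move=> tJ; apply: (tame_dir (u := u) tJ) => _ g.
exact: derivableP (tame1_derivable tJ).
Qed.

Lemma tame1_continuous k J : tame1 k.+1 J -> continuous J.
Proof. by move=> tJ; exact: (tame_continuous (x := point) (tame_le (ltn0Sn k) tJ)). Qed.

Lemma tame_class_C3 J : tame1 4 J -> class_C3 J.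
Proof.
move=> tJ u v w g; split.
- exact: tame1_derivable tJ.
- exact: tame1_derivable (tame1_derive u tJ).
- exact: tame1_derivable (tame1_derive v (tame1_derive u tJ)).
- exact: (tame1_continuous (tame1_derive w (tame1_derive v (tame1_derive u tJ))) (x := g)).
Qed.

Lemma tame1_derive_sum k J u : tame1 k.+1 J ->
  'D_u J = fun g => \sum_j u ord0 j * 'D_(delta_mx ord0 j) J g.
Proof.
move=> /tame_partials[dJ dJ_tame dJE]; apply/funext => g.
rewrite (derive_val (is_derive := dJE point g u)); apply: eq_bigr => j _.
rewrite (derive_val (is_derive := dJE point g (delta_mx ord0 j))).
rewrite (bigD1 j)//= big1 ?addr0 => [|i /negbTE ij]; last by rewrite mxE ij mul0r.
by rewrite mxE !eqxx mul1r.
Qed.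

(** Linearity of the derivative in its direction, applied twice. *)
Lemma tame_hessianE J g h : tame1 2 J ->
  (h *m hessian J g *m h^T) ord0 ord0 = 'D_h ('D_h J) g.
Proof.
move=> tJ; rewrite [in RHS](tame1_derive_sum h tJ).
have D i : is_derive g h (fun v => h ord0 i * 'D_(delta_mx ord0 i) J v)
    (h ord0 i * \sum_j h ord0 j * 'D_(delta_mx ord0 j) ('D_(delta_mx ord0 i) J) g).
  apply: is_derive_scale; rewrite -(congr1 (@^~ g) (tame1_derive_sum h (tame1_derive _ tJ))).
  exact: derivableP (tame1_derivable (tame1_derive _ tJ)).
rewrite (derive_val (is_derive := is_derive_bigsum D)) !mxE.
apply: eq_bigr => i _; rewrite !mxE mulrC; congr (_ * _).
by apply: eq_bigr => j _; rewrite !mxE.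
Qed.

Lemma derive1_line J g h : (forall v, derivable J v h) ->
  derive1 (fun t : R => J (g + t *: h)) = fun t => 'D_h J (g + t *: h).
Proof.
move=> dJ; apply/funext => t; rewrite derive1E.
apply: derive_val; apply/(is_derive_line J); exact: derivableP.
Qed.

Lemma tame_third_derivativeE J g h : tame1 3 J ->
  third_directional_derivative J g h = 'D_h ('D_h ('D_h J)) g.
Proof.
move=> tJ; have t2 := tame1_derive h tJ; have t1 := tame1_derive h t2.
rewrite /third_directional_derivative /derive1n /=.
rewrite (derive1_line _ (J := J)) => [|v]; last exact: tame1_derivable tJ.
rewrite (derive1_line _ (J := 'D_h J)) => [|v]; last exact: tame1_derivable t2.
rewrite (derive1_line _ (J := 'D_h ('D_h J))) => [|v]; last exact: tame1_derivable t1.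
by rewrite scale0r addr0.
Qed.

End regularity.

(** * Central moments and the third-order bound *)

Section moments.
Context {R : realType} {n : nat}.
Variables (q h : 'I_n -> R).
Hypothesis q_ge0 : forall j, 0 <= q j.
Hypothesis q_sum1 : \sum_j q j = 1.

Let M (k : nat) := \sum_j h j ^+ k * q j.

(** The three moments and the normalization determine the expectation of any
    cubic polynomial; both central moments below are instances. *)
Lemma sum_cubic (a b c d : R) :
  \sum_j q j * (a * h j ^+ 3 + b * h j ^+ 2 + c * h j + d) =
  a * M 3 + b * M 2 + c * M 1 + d.
Proof.
rewrite -[in RHS](mulr1 d) -q_sum1 /M !mulr_sumr -!big_split /=.
by apply: eq_bigr => j _; ring.
Qed.

Lemma varianceE : M 2 - M 1 ^+ 2 = \sum_j q j * (h j - M 1) ^+ 2.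
Proof.
transitivity (0 * M 3 + 1 * M 2 + (- 2 * M 1) * M 1 + M 1 ^+ 2); first by ring.
by rewrite -sum_cubic; apply: eq_bigr => j _; ring.
Qed.

Lemma third_cumulantE :
  M 3 - 3 * M 1 * M 2 + 2 * M 1 ^+ 3 = \sum_j q j * (h j - M 1) ^+ 3.
Proof.
transitivity (1 * M 3 + (- 3 * M 1) * M 2 + (3 * M 1 ^+ 2) * M 1 + - M 1 ^+ 3).
  by ring.
by rewrite -sum_cubic; apply: eq_bigr => j _; ring.
Qed.

Lemma variance_ge0 : 0 <= M 2 - M 1 ^+ 2.
Proof.
by rewrite varianceE sumr_ge0// => j _; rewrite mulr_ge0 ?sqr_ge0.
Qed.

Lemma mean_le (H : R) : (forall j, `|h j| <= H) -> `|M 1| <= H.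
Proof.
move=> hH; apply: le_trans (ler_norm_sum _ _ _) _.
rewrite -[H]mulr1 -q_sum1 mulr_sumr; apply: ler_sum => j _.
by rewrite expr1 normrM (ger0_norm (q_ge0 j)) ler_wpM2r.
Qed.

(** The third central moment is the mean of (h - m)^3, and |h - m| <= 2 H. *)
Lemma third_cumulant_le (H : R) : (forall j, `|h j| <= H) ->
  `|M 3 - 3 * M 1 * M 2 + 2 * M 1 ^+ 3| <= 2 * H * (M 2 - M 1 ^+ 2).
Proof.
move=> hH; rewrite third_cumulantE varianceE.
apply: le_trans (ler_norm_sum _ _ _) _; rewrite mulr_sumr; apply: ler_sum => j _.
rewrite normrM (ger0_norm (q_ge0 j)) mulrCA ler_wpM2l// exprS normrM.
rewrite normrX real_normK ?num_real// ler_wpM2r ?sqr_ge0//.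
rewrite (le_trans (ler_normB _ _))// (_ : 2 * H = H + H) ?lerD//; last by ring.
exact: mean_le.
Qed.

End moments.

(** Here m, v, k stand for the mean, variance and third central moment. The m^3
    term is charged to P2 m^2; the mixed term and the k term cost 3 P2 and 2 P1
    times H v, and together are charged to P1 v. *)
Lemma third_order_bound {R : realFieldType} (M H P1 P2 P3 m v k : R) :
  0 <= P1 -> 0 <= P2 -> `|P3| <= M * P2 -> 3 * P2 + 2 * P1 <= M * P1 ->
  0 <= v -> `|m| <= H -> `|k| <= 2 * H * v ->
  `|P3 * m ^+ 3 + 3 * P2 * m * v + P1 * k| <= M * H * (P2 * m ^+ 2 + P1 * v).
Proof.
move=> P10 P20 P3M P2M v0 mH kH.
have H0 : 0 <= H by apply: le_trans mH.
have -> : M * H * (P2 * m ^+ 2 + P1 * v) =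
  (M * P2) * (H * m ^+ 2) + (M * P1) * (H * v) by ring.
have a1 : `|P3 * m ^+ 3| <= (M * P2) * (H * m ^+ 2).
  rewrite normrM ler_pM// exprS normrM normrX real_normK ?num_real//.
  by rewrite ler_wpM2r ?sqr_ge0.
have a2 : `|3 * P2 * m * v| <= 3 * P2 * (H * v).
  rewrite !normrM (ger0_norm v0) (ger0_norm P20) ger0_norm //.
  by rewrite -!mulrA !ler_wpM2l// ler_wpM2r.
have a3 : `|P1 * k| <= 2 * P1 * (H * v).
  rewrite normrM (ger0_norm P10) (_ : 2 * P1 * (H * v) = P1 * (2 * H * v)); last ring.
  by rewrite ler_wpM2l.
have a4 : (3 * P2 + 2 * P1) * (H * v) <= M * P1 * (H * v).
  by rewrite ler_wpM2r ?mulr_ge0.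
apply: le_trans (ler_normD _ _) _.
apply: le_trans (lerD (ler_normD _ _) (lexx _)) _.
by apply: le_trans (lerD (lerD a1 a2) a3) _; rewrite -addrA lerD2l -mulrDl.
Qed.

(** * Gibbs weights and functions of the partition function *)

Section gibbs.
Context {R : realType} {X : ptopologicalType} {Y : topologicalType} {n : nat}.
Variables (beta : 'I_n -> R) (y : 'I_n -> Y) (c : X -> Y -> R) (eps : R).
Hypothesis n_gt0 : (0 < n)%N.
Hypothesis beta_gt0 : forall j, 0 < beta j.
Hypothesis c_ge0 : forall x z, 0 <= c x z.
Hypothesis c_cont : forall z, continuous (c ^~ z).
Hypothesis eps_gt0 : 0 < eps.
Local Notation V := 'rV[R]_n.
Local Notation B := (B_ beta y c eps).
Local Notation Z := (Z_ beta y c eps).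
Implicit Types (x : X) (g u h : V).

Definition gibbs (j : 'I_n) x g := B j x g / Z x g.
Definition moment (k : nat) h x g := \sum_j h ord0 j ^+ k * gibbs j x g.

Lemma B_gt0 j x g : 0 < B j x g.
Proof. by rewrite mulr_gt0 ?expR_gt0. Qed.

Lemma B_le_Z j x g : B j x g <= Z x g.
Proof.
by rewrite /Z_ (bigD1 j)//= lerDl sumr_ge0// => i _; exact/ltW/B_gt0.
Qed.

Lemma Z_gt0 x g : 0 < Z x g.
Proof. exact: lt_le_trans (B_gt0 (Ordinal n_gt0) x g) (B_le_Z _ _ _). Qed.

Lemma Z_neq0 x g : Z x g != 0. Proof. by rewrite gt_eqF ?Z_gt0. Qed.

Lemma gibbs_ge0 j x g : 0 <= gibbs j x g.
Proof. by rewrite divr_ge0 ?ltW ?B_gt0 ?Z_gt0. Qed.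

Lemma gibbs_le1 j x g : gibbs j x g <= 1.
Proof. by rewrite ler_pdivrMr ?Z_gt0// mul1r B_le_Z. Qed.

Lemma gibbs_sum1 x g : \sum_j gibbs j x g = 1.
Proof. by rewrite -mulr_suml divff ?Z_neq0. Qed.

(** The cost is nonnegative, so dropping it bounds Z uniformly in x. *)
Lemma Z_le (K : R) : exists2 C, 0 < C & forall x g, `|g| <= K -> Z x g <= C.
Proof.
exists (\sum_j beta j * expR (K / eps)).
  rewrite (bigD1 (Ordinal n_gt0))//= ltr_wpDr ?mulr_gt0 ?expR_gt0//.
  by apply: sumr_ge0 => i _; rewrite ltW// mulr_gt0 ?expR_gt0.
move=> x g gK; apply: ler_sum => j _.
rewrite ler_pM2l// ler_expR ler_pM2r ?invr_gt0//.
rewrite (le_trans _ (le_trans (coord_le_norm g j) gK))//.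
by rewrite (le_trans _ (ler_norm _))// lerBlDr lerDl.
Qed.

Lemma B_cont j g : continuous (B j ^~ g).
Proof.
move=> x; rewrite /B_; apply: cvgM; first exact: cvg_cst.
apply: continuous_comp; last exact: continuous_expR.
apply: cvgM; last exact: cvg_cst.
by apply: cvgB; [exact: cvg_cst | exact: c_cont].
Qed.

Lemma Z_cont g : continuous (Z ^~ g).
Proof.
rewrite /Z_; apply: continuous_big => [|j _]; [exact: add_continuous | exact: B_cont].
Qed.

Lemma is_derive_B j x g u :
  is_derive g u (B j x) (u ord0 j * (B j x g / eps)).
Proof.
have dL : is_derive g u (fun v : V => eps^-1 * (v ord0 j + - c x (y j)))
    (eps^-1 * (u ord0 j + 0)).
  apply: is_derive_scale; apply: is_derive_add; exact: is_derive_coord.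
have := is_derive_scale (beta j) (is_derive_comp_dir (is_derive_expR _) dL).
have -> : (fun v : V => beta j * expR (eps^-1 * (v ord0 j + - c x (y j)))) = B j x.
  by apply/funext => v; rewrite mulrC [eps^-1 * _]mulrC mulrC.
move=> /is_derive_eq; apply; rewrite /B_ addr0 (mulrC eps^-1 (_ + _)); ring.
Qed.

Lemma is_derive_Z x g u :
  is_derive g u (Z x) (Z x g * (moment 1 u x g / eps)).
Proof.
have /is_derive_eq := is_derive_bigsum (fun j => is_derive_B j x g u).
apply; rewrite /moment mulr_suml mulr_sumr; apply: eq_bigr => j _.
by rewrite /gibbs expr1; field; rewrite Z_neq0 gt_eqF.
Qed.

(** The chain rule in the variable ln Z: psi is the derivative of phi with
    respect to ln z, and ln Z has derivative the Gibbs mean of u over eps. *)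
Lemma is_derive_phiZ (phi psi : R -> R) x g u :
  (forall z : R, 0 < z -> is_derive z 1 phi (psi z / z)) ->
  is_derive g u (fun v => phi (Z x v)) (psi (Z x g) * (moment 1 u x g / eps)).
Proof.
move=> dphi.
have /is_derive_eq := is_derive_comp_dir (dphi _ (Z_gt0 x g)) (is_derive_Z x g u).
by apply; rewrite mulrA divfK ?Z_neq0.
Qed.

Lemma is_derive_gibbs j x g u :
  is_derive g u (gibbs j x) (gibbs j x g * (u ord0 j - moment 1 u x g) / eps).
Proof.
have dV : forall z : R, 0 < z -> is_derive z 1 GRing.inv ((- z^-1) / z).
  move=> z z0; have z1 : z != 0 by rewrite gt_eqF.
  have /is_derive_eq := is_deriveV (f := id) z1 (is_derive_id z 1).
  by apply; rewrite /GRing.scale /= mulr1 mulNr -expr2 exprVn.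
have /is_derive_eq := is_derive_mul (is_derive_B j x g u) (is_derive_phiZ x g u dV).
by apply; rewrite /gibbs; field; rewrite Z_neq0 gt_eqF.
Qed.

(** Differentiating a Gibbs average along h produces a covariance with h. *)
Lemma is_derive_moment k h x g :
  is_derive g h (moment k h x)
    ((moment k.+1 h x g - moment k h x g * moment 1 h x g) / eps).
Proof.
have /is_derive_eq := is_derive_bigsum
  (fun j => is_derive_scale (h ord0 j ^+ k) (is_derive_gibbs j x g h)).
apply; set m := moment 1 h x g.
rewrite /moment mulr_suml -sumrB mulr_suml.
by apply: eq_bigr => j _; rewrite exprS; ring.
Qed.

(** The partial derivative q_j (delta_ij - q_i) / eps is a polynomial in the
    weights, and the weights are bounded by 1. *)
Lemma gibbs_tame k j : tame k (gibbs j).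
Proof.
have t0 i : tame0 (gibbs i).
  split=> [g x|K].
    apply: cvgM; first exact: B_cont.
    by apply: cvgV; [exact: Z_neq0 | exact: Z_cont].
  by exists 1 => x g _; rewrite ger0_norm ?gibbs_ge0 ?gibbs_le1.
elim: k j => [|k IH] j; first exact: t0.
split; first exact: t0.
exists (fun i x g => eps^-1 * (gibbs j x g * ((i == j)%:R + -1 * gibbs i x g))).
  move=> i; apply/tameZ/tameM; first exact: IH.
  by apply: tameD; [exact: tame_cst | apply: tameZ; exact: IH].
move=> x g u; have /is_derive_eq := is_derive_gibbs j x g u; apply.
transitivity (eps^-1 * (gibbs j x g *
    (\sum_i u ord0 i * (i == j)%:R + -1 * moment 1 u x g))).
  rewrite (bigD1 j)//= eqxx mulr1 big1 => [|i /negbTE ->]; last by rewrite mulr0.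
  by ring.
rewrite /moment mulr_sumr -big_split/= !mulr_sumr; apply: eq_bigr => i _.
by rewrite expr1; ring.
Qed.

Lemma tame0_phiZ (phi dphi : R -> R) :
  (forall z : R, 0 < z -> is_derive z 1 phi (dphi z)) ->
  (forall K : R, exists C : R, forall z, 0 < z -> z <= K -> `|phi z| <= C) ->
  tame0 (fun x g => phi (Z x g)).
Proof.
move=> dphi_ phib; split=> [g x|K].
  apply: continuous_comp; first exact: Z_cont.
  apply/differentiable_continuous/derivable1_diffP.
  by case: (dphi_ _ (Z_gt0 x g)).
have [K' _ hK] := Z_le K; have [C hC] := phib K'.
by exists C => x g /hK ZK; apply: hC => //; exact: Z_gt0.
Qed.

Lemma tameS_phiZ k (phi psi : R -> R) :
  (forall z : R, 0 < z -> is_derive z 1 phi (psi z / z)) ->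
  (forall K : R, exists C : R, forall z, 0 < z -> z <= K -> `|phi z| <= C) ->
  tame k (fun x g => psi (Z x g)) -> tame k.+1 (fun x g => phi (Z x g)).
Proof.
move=> dphi phib tpsi; split; first exact: tame0_phiZ dphi phib.
exists (fun j x g => eps^-1 * (psi (Z x g) * gibbs j x g)) => [j|x g u].
  by apply/tameZ/tameM => //; exact: gibbs_tame.
have /is_derive_eq := is_derive_phiZ x g u dphi; apply.
rewrite /moment mulr_suml mulr_sumr; apply: eq_bigr => j _.
by rewrite expr1; ring.
Qed.

(** * Self-concordance from a scalar profile *)

Section master.
Variables (mu : {finite_measure set (borel X) -> \bar R}) (rho2 : R).
Hypothesis rho2_gt0 : 0 < rho2.
Local Notation pen := (target_penalty beta rho2).

Let dpen h g : R := \sum_j h ord0 j * (beta j * (g ord0 j / rho2 - 1)).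
Let ddpen h : R := \sum_j beta j * h ord0 j ^+ 2 / rho2.

Lemma target_penalty_tame k : tame k (fun (_ : X) g => pen g).
Proof.
apply: (@tame_ext _ _ _ _ (fun (_ : X) (g : V) => \sum_j beta j *
   ((2 * rho2)^-1 * (g ord0 j * g ord0 j) + -1 * g ord0 j))).
  by move=> _ g; apply: eq_bigr => j _; ring.
apply: tame_sum => j; apply/tameZ/tameD; apply: tameZ; last exact: tame_coord.
by apply: tameM; exact: tame_coord.
Qed.

Lemma is_derive_target_penalty g h : is_derive g h pen (dpen h g).
Proof.
have D j : is_derive g h (fun v : V => beta j *
    ((2 * rho2)^-1 * (v ord0 j * v ord0 j) + -1 * v ord0 j))
    (h ord0 j * (beta j * (g ord0 j / rho2 - 1))).
  have d := is_derive_coord j g h.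
  have /is_derive_eq := is_derive_scale (beta j) (is_derive_add
    (is_derive_scale (2 * rho2)^-1 (is_derive_mul d d)) (is_derive_scale (-1) d)).
  by apply; field; rewrite gt_eqF.
have := is_derive_bigsum D; congr is_derive.
by apply/funext => v; apply: eq_bigr => j _; ring.
Qed.

Lemma is_derive_dpen g h : is_derive g h (dpen h) (ddpen h).
Proof.
have D j : is_derive g h (fun v : V => (h ord0 j * beta j) * (rho2^-1 * v ord0 j + -1))
    (beta j * h ord0 j ^+ 2 / rho2).
  have /is_derive_eq := is_derive_scale (h ord0 j * beta j) (is_derive_add
    (is_derive_scale rho2^-1 (is_derive_coord j g h)) (is_derive_cst (-1 : R) g h)).
  by apply; ring.
have := is_derive_bigsum D; congr is_derive.
by apply/funext => v; apply: eq_bigr => j _; ring.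
Qed.

Lemma ddpen_ge0 h : 0 <= ddpen h.
Proof.
apply: sumr_ge0 => j _.
by apply/divr_ge0/ltW => //; apply: mulr_ge0 (ltW _) (sqr_ge0 _).
Qed.

(* P1, P2, P3 are the successive derivatives of P0 with respect to ln z. *)
Variables (P0 P1 P2 P3 : R -> R) (M C : R).
Hypothesis M_ge0 : 0 <= M.
Hypothesis C_ge0 : 0 <= C.
Hypothesis dP0 : forall z : R, 0 < z -> is_derive z 1 P0 (P1 z / z).
Hypothesis dP1 : forall z : R, 0 < z -> is_derive z 1 P1 (P2 z / z).
Hypothesis dP2 : forall z : R, 0 < z -> is_derive z 1 P2 (P3 z / z).
Hypothesis P1_ge0 : forall z : R, 0 < z -> 0 <= P1 z.
Hypothesis P2_ge0 : forall z : R, 0 < z -> 0 <= P2 z.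
Hypothesis P3_le : forall z : R, 0 < z -> `|P3 z| <= M * P2 z.
Hypothesis P2_le : forall z : R, 0 < z -> 3 * P2 z + 2 * P1 z <= M * P1 z.
Hypothesis P0_tame : tame 4 (fun x g => P0 (Z x g)).

Let J (g : V) : R := C * \int[mu]_x P0 (Z x g) + pen g.

Let F1 h x g := eps^-1 * (P1 (Z x g) * moment 1 h x g).
Let F2 h x g := eps^-1 ^+ 2 * (P2 (Z x g) * moment 1 h x g ^+ 2 +
  P1 (Z x g) * (moment 2 h x g - moment 1 h x g ^+ 2)).
Let F3 h x g := eps^-1 ^+ 3 * (P3 (Z x g) * moment 1 h x g ^+ 3 +
  3 * P2 (Z x g) * moment 1 h x g * (moment 2 h x g - moment 1 h x g ^+ 2) +
  P1 (Z x g) * (moment 3 h x g - 3 * moment 1 h x g * moment 2 h x g +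
                2 * moment 1 h x g ^+ 3)).

Lemma is_derive_F0 h x g : is_derive g h (fun v => P0 (Z x v)) (F1 h x g).
Proof.
by have /is_derive_eq := is_derive_phiZ x g h dP0; apply; rewrite /F1; ring.
Qed.

Lemma is_derive_F1 h x g : is_derive g h (F1 h x) (F2 h x g).
Proof.
have /is_derive_eq := is_derive_scale eps^-1
  (is_derive_mul (is_derive_phiZ x g h dP1) (is_derive_moment 1 h x g)).
by apply; rewrite /F2; ring.
Qed.

Lemma is_derive_F2 h x g : is_derive g h (F2 h x) (F3 h x g).
Proof.
have m1 := is_derive_moment 1 h x g.
have m2 := is_derive_moment 2 h x g.
have m11 := is_derive_mul m1 m1.
have /is_derive_eq := is_derive_scale (eps^-1 ^+ 2) (is_derive_add
  (is_derive_mul (is_derive_phiZ x g h dP2) m11)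
  (is_derive_mul (is_derive_phiZ x g h dP1)
     (is_derive_add m2 (is_derive_scale (-1) m11)))).
move=> /(_ (F3 h x g)) D.
have -> : F2 h x = (fun v => eps^-1 ^+ 2 * (P2 (Z x v) * (moment 1 h x v * moment 1 h x v) +
    P1 (Z x v) * (moment 2 h x v + -1 * (moment 1 h x v * moment 1 h x v)))).
  by apply/funext => v; rewrite /F2; ring.
by apply: D; rewrite /F3; ring.
Qed.

Lemma F3_le h x g : `|F3 h x g| <= M / eps * `|h| * F2 h x g.
Proof.
have q0 j := gibbs_ge0 j x g; have q1 := gibbs_sum1 x g.
have hj j := coord_le_norm h j.
have := third_order_bound (P1_ge0 (Z_gt0 x g)) (P2_ge0 (Z_gt0 x g))
  (P3_le (Z_gt0 x g)) (P2_le (Z_gt0 x g))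
  (variance_ge0 (fun j => h ord0 j) q0 q1) (mean_le q0 q1 hj) (third_cumulant_le q0 q1 hj).
have e0 : 0 <= eps^-1 ^+ 3 by rewrite exprn_ge0// invr_ge0 ltW.
move=> /(ler_wpM2l e0); rewrite -[X in X * `|_|](ger0_norm e0) -normrM => b.
apply: le_trans b _; rewrite le_eqVlt; apply/orP; left; apply/eqP.
by rewrite /F2 /moment; ring.
Qed.

(** Integrating the pointwise bound [F3_le]; the penalty contributes only the
    nonnegative [ddpen] to the Hessian. *)
Lemma gsc_of_profile : generalized_self_concordant (M / eps) J.
Proof.
have tF1 h : tame 3 (F1 h) := tame_dir P0_tame (is_derive_F0 h).
have tF2 h : tame 2 (F2 h) := tame_dir (tF1 h) (is_derive_F1 h).
have tF3 h : tame 1 (F3 h) := tame_dir (tF2 h) (is_derive_F2 h).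
have tJ : tame1 (X := X) 4 J.
  by apply: tameD; [exact/tameZ/tame_Rintegral | exact: target_penalty_tame].
split=> [|g h]; first exact: (tame_class_C3 tJ).
have dJ v : is_derive v h J (C * (\int[mu]_x F1 h x v) + dpen h v).
  apply: is_derive_add; last exact: is_derive_target_penalty.
  apply: is_derive_scale; apply: is_derive_Rintegral (is_derive_F0 h) v.
    exact: tame_tame0 P0_tame.
  exact: tame_tame0 (tF1 h).
have D1 : 'D_h J = fun v => C * (\int[mu]_x F1 h x v) + dpen h v.
  by apply/funext => v; rewrite (derive_val (is_derive := dJ v)).
have ddJ v : is_derive v h ('D_h J) (C * (\int[mu]_x F2 h x v) + ddpen h).
  rewrite D1; apply: is_derive_add; last exact: is_derive_dpen.
  apply: is_derive_scale; apply: is_derive_Rintegral (is_derive_F1 h) v.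
    exact: tame_tame0 (tF1 h).
  exact: tame_tame0 (tF2 h).
have D2 : 'D_h ('D_h J) = fun v => C * (\int[mu]_x F2 h x v) + ddpen h.
  by apply/funext => v; rewrite (derive_val (is_derive := ddJ v)).
have dddJ : is_derive g h ('D_h ('D_h J)) (C * (\int[mu]_x F3 h x g) + 0).
  rewrite D2; apply: is_derive_add.
  apply: is_derive_scale; apply: is_derive_Rintegral (is_derive_F2 h) g.
    exact: tame_tame0 (tF2 h).
  exact: tame_tame0 (tF3 h).
have tJ3 : tame1 (X := X) 3 J by exact: (tame_le (l := 4) _ tJ).
have tJ2 : tame1 (X := X) 2 J by exact: (tame_le (l := 4) _ tJ).
rewrite (tame_third_derivativeE g h tJ3) (tame_hessianE g h tJ2).
rewrite (derive_val (is_derive := dddJ)) (derive_val (is_derive := ddJ g)).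
rewrite addr0 mulrDr.
have H0 : 0 <= M / eps * `|h| by rewrite mulr_ge0// divr_ge0// ltW.
apply: (@le_trans _ _ (M / eps * `|h| * (C * \int[mu]_x F2 h x g))); last first.
  by rewrite lerDl mulr_ge0// ddpen_ge0.
rewrite normrM (ger0_norm C_ge0) mulrCA ler_wpM2l//.
have iF2 := tame_integrable mu g (tF2 h); have iF3 := tame_integrable mu g (tF3 h).
apply: le_trans (le_normr_Rintegral measurableT iF3) _.
rewrite -RintegralZl//; apply: le_Rintegral => //.
- exact/integrable_norm.
- exact: (tame_integrable mu g (tameZ _ (tF2 h))).
- by move=> x _; exact: F3_le.
Qed.

End master.

End gibbs.

(** * The Lambert function *)

Section lambert.
Context {R : realType}.
Local Notation W := (@lambertW R).
Local Notation f := (fun z : R => z * expR z).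

Lemma is_derive_xexp (z : R) : is_derive z 1 f ((1 + z) * expR z).
Proof.
have /is_derive_eq := is_derive_mul (is_derive_id z 1) (is_derive_expR z).
by apply; ring.
Qed.

Lemma xexp_cont : continuous f.
Proof.
move=> z; apply/differentiable_continuous/derivable1_diffP.
by case: (is_derive_xexp z).
Qed.

Lemma xexp_inj : {in [set z : R | 0 <= z] &, injective f}.
Proof.
have lt (x y : R) : 0 <= x -> x < y -> f x < f y.
  by move=> x0 xy; rewrite ltr_pM ?ltr_expR ?expR_ge0.
move=> x y /set_mem/= x0 /set_mem/= y0 fxy.
case: (ltgtP x y) => // xy.
  by have := lt _ _ x0 xy; rewrite fxy ltxx.
by have := lt _ _ y0 xy; rewrite fxy ltxx.
Qed.

Let expR_ge1 (z : R) : 0 <= z -> 1 <= expR z.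
Proof. by move=> z0; rewrite -expR0 ler_expR. Qed.

(** Intermediate value theorem on [0, u], where f u >= u. *)
Lemma xexp_surj : set_surj [set z : R | 0 <= z] [set u : R | 0 <= u] f.
Proof.
move=> u /= u0.
have fu : u <= f u by rewrite ler_peMr// expR_ge1.
have [||z zu fz] := @IVT _ f 0 u u u0.
- exact/continuous_subspaceT/xexp_cont.
- by rewrite mul0r ge_min u0 /= le_max fu orbT.
by exists z => //=; move: zu; rewrite in_itv /= => /andP[].
Qed.

Lemma lambertW_ge0 (u : R) : 0 <= u -> 0 <= W u.
Proof.
move=> u0; apply: (surjpinv_image_sub (dflt := fun=> 0) xexp_surj).
by exists u.
Qed.

Lemma lambertWK (u : R) : 0 <= u -> W u * expR (W u) = u.
Proof. by move=> u0; apply: (surjpK (fun=> 0) xexp_surj); rewrite inE. Qed.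

Lemma xexpK (z : R) : 0 <= z -> W (z * expR z) = z.
Proof. by move=> z0; apply: (pinvKV (fun=> 0) xexp_inj); rewrite inE. Qed.

Lemma lambertW_gt0 (u : R) : 0 < u -> 0 < W u.
Proof.
move=> u0; rewrite lt_neqAle lambertW_ge0 ?ltW// andbT eq_sym.
apply/eqP => W0; have := lambertWK (ltW u0).
by rewrite W0 mul0r => u00; rewrite -u00 ltxx in u0.
Qed.

Lemma lambertW_le (u : R) : 0 <= u -> W u <= u.
Proof.
move=> u0; rewrite -{2}(lambertWK u0) ler_peMr ?lambertW_ge0//.
by rewrite expR_ge1 ?lambertW_ge0.
Qed.

(** The value 1 / ((1 + w) e^w) given by the inverse function theorem is
    rewritten with e^w = u / w, the form in which [is_derive_phiZ] reads off
    the derivative with respect to ln u. *)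
Lemma is_derive_lambertW (u : R) : 0 < u ->
  is_derive u 1 W (W u / (1 + W u) / u).
Proof.
move=> u0; have w0 := lambertW_gt0 u0; set w := W u in w0 *.
have uE : f w = u by exact: lambertWK (ltW u0).
have d0 : (1 + w) * expR w != 0.
  by rewrite gt_eqF// mulr_gt0 ?expR_gt0// addr_gt0.
have /is_derive_eq : is_derive (f w) 1 W ((1 + w) * expR w)^-1.
  apply: (is_derive_inverse (f := f)) => //.
  - near=> z; apply: xexpK; rewrite ltW//; near: z; exact: lt_nbhsr.
  - by near=> z; exact: xexp_cont.
  - exact: is_derive_xexp.
rewrite uE; apply; rewrite -[in RHS]uE; field.
by rewrite !gt_eqF ?expR_gt0 ?addr_gt0.
Unshelve. all: by end_near. Qed.

Lemma is_derive_lambertWM (k z : R) : 0 < k -> 0 < z ->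
  is_derive z 1 (fun s => W (k * s)) (W (k * z) / (1 + W (k * z)) / z).
Proof.
move=> k0 z0; have kz : 0 < k * z by rewrite mulr_gt0.
have /is_derive_eq := is_derive1_comp (g := fun s => k * s)
  (is_derive_lambertW kz) (is_derive_scale k (is_derive_id z 1)).
apply; field; rewrite !gt_eqF// addr_gt0 // lambertW_gt0 //.
Qed.

End lambert.

(** * The two sources *)

Section sources.
Context {R : realType} {X : ptopologicalType} {Y : topologicalType} {n : nat}.
Variables (mu : {finite_measure set (borel X) -> \bar R}).
Variables (beta : 'I_n -> R) (y : 'I_n -> Y) (c : X -> Y -> R).
Variables (eps rho1 rho2 : R).
Hypothesis n_gt0 : (0 < n)%N.
Hypothesis beta_gt0 : forall j, 0 < beta j.
Hypothesis c_ge0 : forall x z, 0 <= c x z.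
Hypothesis c_cont : forall z, continuous (c ^~ z).
Hypothesis eps_gt0 : 0 < eps.
Hypothesis rho1_gt0 : 0 < rho1.
Hypothesis rho2_gt0 : 0 < rho2.
Local Notation Z := (Z_ beta y c eps).

Lemma powR_profile (a z : R) : 0 < z ->
  is_derive z 1 (fun s : R => s `^ a) (a * z `^ a / z).
Proof.
move=> z0; have /is_derive_eq := @is_derive1_powR R a z z0; apply.
by rewrite -mulrA powRB ?(gt_eqF z0) ?implybT// powRr1 ?ltW.
Qed.

Lemma powR_bounded (a K : R) : 0 < a ->
  exists C : R, forall z, 0 < z -> z <= K -> `|z `^ a| <= C.
Proof.
move=> a0; exists (K `^ a) => z z0 zK.
rewrite ger0_norm ?powR_ge0//; apply: ge0_ler_powR => //; rewrite ?nnegrE ltW//.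
exact: lt_le_trans zK.
Qed.

Lemma powR_Z_tame (a : R) k : 0 < a -> tame k (fun x g => Z x g `^ a).
Proof.
move=> a0; elim: k => [|k IH].
  apply: (tame0_phiZ y n_gt0 beta_gt0 c_ge0 c_cont eps_gt0
    (phi := fun s => s `^ a)) => //.
  by move=> K; exact: powR_bounded.
apply: (tameS_phiZ n_gt0 beta_gt0 c_ge0 c_cont eps_gt0
  (phi := fun s : R => s `^ a) (psi := fun z => a * z `^ a)) => //.
- exact: powR_profile.
- by move=> K; exact: powR_bounded.
- exact: tameZ.
Qed.

(** With P_i = a^i z^a the two conditions of [third_order_bound] read,
    up to a positive factor, a <= 2 + 3 a and 3 a^2 + 2 a <= (2 + 3 a) a; the second is an equality. *)
Lemma gsc_powR (a C : R) : 0 < a -> 0 <= C ->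
  generalized_self_concordant ((2 + 3 * a) / eps)
    (fun g => C * \int[mu]_x (Z x g `^ a) + target_penalty beta rho2 g).
Proof.
move=> a0 C0.
have D (i : nat) (z : R) : 0 < z ->
    is_derive z 1 (fun s : R => a ^+ i * s `^ a) (a ^+ i.+1 * z `^ a / z).
  move=> z0; have /is_derive_eq := is_derive_scale (a ^+ i) (powR_profile a z0).
  by apply; rewrite exprS; ring.
apply: (gsc_of_profile n_gt0 beta_gt0 eps_gt0 mu rho2_gt0
  (P0 := fun s : R => s `^ a) (P1 := fun z => a ^+ 1 * z `^ a)
  (P2 := fun z => a ^+ 2 * z `^ a) (P3 := fun z => a ^+ 3 * z `^ a)) => //.
- by rewrite addr_ge0// mulr_ge0// ltW.
- by move=> z z0; rewrite expr1; exact: powR_profile.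
- by move=> z z0; rewrite mulr_ge0 ?exprn_ge0 ?powR_ge0 ?ltW.
- by move=> z z0; rewrite mulr_ge0 ?exprn_ge0 ?powR_ge0 ?ltW.
- move=> z z0; rewrite ger0_norm ?mulr_ge0 ?exprn_ge0 ?powR_ge0 ?(ltW a0)//.
  rewrite mulrA ler_wpM2r ?powR_ge0// exprS ler_wpM2r ?sqr_ge0//.
  by lra.
- move=> z z0; rewrite le_eqVlt; apply/orP; left; apply/eqP; ring.
- exact: powR_Z_tame.
Qed.

Lemma gsc_KL : generalized_self_concordant ((2 + 3 * alpha eps rho1) / eps)
  (semi_dual_KL mu beta y c eps rho1 rho2).
Proof.
by apply: gsc_powR; [rewrite /alpha divr_gt0 ?addr_gt0 | rewrite addr_ge0 ?ltW].
Qed.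

Section lambert_profile.
Variable kappa : R.
Hypothesis kappa_gt0 : 0 < kappa.
Local Notation W z := (lambertW (kappa * z)).
Local Notation r z := (1 + W z)^-1.

Let W_gt0 (z : R) : 0 < z -> 0 < W z.
Proof. by move=> z0; rewrite lambertW_gt0 ?mulr_gt0. Qed.

Let W_bounded (K : R) : exists C : R, forall z, 0 < z -> z <= K -> `|W z| <= C.
Proof.
exists (kappa * K) => z z0 zK; rewrite gtr0_norm ?W_gt0//.
by rewrite (le_trans (lambertW_le _)) ?mulr_ge0 ?ler_pM2l// ltW.
Qed.

Let r_bounded (K : R) : exists C : R, forall z, 0 < z -> z <= K -> `|r z| <= C.
Proof.
exists 1 => z z0 _; have := W_gt0 z0 => w0.
by rewrite ger0_norm ?invr_ge0 ?invf_le1 ?lerDl ?addr_ge0 ?addr_gt0 ?ltW.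
Qed.

Let dW (z : R) : 0 < z -> is_derive z 1 (fun z => W z) (W z * r z / z).
Proof. exact: is_derive_lambertWM. Qed.

Let dr (z : R) : 0 < z -> is_derive z 1 (fun z => r z) (- (W z * r z ^+ 3) / z).
Proof.
move=> z0; have w1 : 1 + W z != 0 by rewrite gt_eqF// addr_gt0// W_gt0.
have /is_derive_eq := is_deriveV (f := fun s => 1 + W s) w1
  (is_derive_add (is_derive_cst (1 : R) z 1) (dW z0)).
by apply; rewrite /GRing.scale /=; field; rewrite w1 gt_eqF.
Qed.

(** With w = W (kappa z) and r = 1 / (1 + w), the derivatives with respect to
    ln z are w r for w and - w r^3 for r: polynomials in w and r again, hence
    the joint induction. *)
Lemma lambert_Z_tame k :
  tame k (fun x g => W (Z x g)) /\ tame k (fun x g => r (Z x g)).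
Proof.
elim: k => [|k [IHW IHr]].
  split; first by apply: (tame0_phiZ y n_gt0 beta_gt0 c_ge0 c_cont eps_gt0
    (phi := fun z => W z)) => //; exact: dW.
  by apply: (tame0_phiZ y n_gt0 beta_gt0 c_ge0 c_cont eps_gt0
    (phi := fun z => r z)) => //; exact: dr.
split.
- apply: (tameS_phiZ n_gt0 beta_gt0 c_ge0 c_cont eps_gt0
    (phi := fun z => W z) (psi := fun z => W z * r z)) => //.
  exact: tameM.
- apply: (tameS_phiZ n_gt0 beta_gt0 c_ge0 c_cont eps_gt0
    (phi := fun z => r z) (psi := fun z => - (W z * r z ^+ 3))) => //.
  apply: (tame_ext (f1 := fun x g => -1 * (W (Z x g) *
     (r (Z x g) * (r (Z x g) * r (Z x g)))))) => [x g|]; first by ring.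
  by apply: tameZ; do 3?apply: tameM.
Qed.

(** For w + w^2 / 2 the derivatives with respect to ln z are w, w r and w r^3,
    and 0 <= r <= 1. *)
Lemma gsc_lambertW (C : R) : 0 <= C ->
  generalized_self_concordant (6 / eps)
    (fun g => C * \int[mu]_x (W (Z x g) + 2^-1 * W (Z x g) ^+ 2) +
              target_penalty beta rho2 g).
Proof.
move=> C0.
have w1 (z : R) : 0 < z -> 1 + W z != 0 by move=> z0; rewrite gt_eqF// addr_gt0// W_gt0.
have r0 (z : R) : 0 < z -> 0 <= r z.
  by move=> z0; rewrite invr_ge0 addr_ge0// ltW// W_gt0.
have r1 (z : R) : 0 < z -> r z <= 1.
  by move=> z0; rewrite invf_le1 ?lerDl ?addr_gt0 ?W_gt0// ltW// W_gt0.
apply: (gsc_of_profile n_gt0 beta_gt0 eps_gt0 mu rho2_gt0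
  (P0 := fun z => W z + 2^-1 * W z ^+ 2)
  (P1 := fun z => W z) (P2 := fun z => W z * r z)
  (P3 := fun z => W z * r z ^+ 3)) => //.
- move=> z z0; have d := dW z0.
  have /is_derive_eq := is_derive_add d (is_derive_scale 2^-1 (is_derive_mul d d)).
  by apply; field; rewrite w1 ?gt_eqF.
- move=> z z0.
  have /is_derive_eq := is_derive_mul (dW z0) (dr z0).
  by apply; field; rewrite w1 ?gt_eqF.
- by move=> z z0; rewrite ltW ?W_gt0.
- by move=> z z0; rewrite mulr_ge0 ?r0 ?ltW ?W_gt0.
- move=> z z0; have wr : 0 <= W z * r z by rewrite mulr_ge0 ?r0 ?ltW ?W_gt0.
  have -> : W z * r z ^+ 3 = (W z * r z) * r z ^+ 2 by ring.
  rewrite normrM (ger0_norm wr) mulrC ler_wpM2r//.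
  rewrite ger0_norm ?sqr_ge0// (@le_trans _ _ 1) ?expr_le1 ?r0 ?r1//.
  by rewrite ler1n.
- move=> z z0; have := W_gt0 z0; have := ler_wpM2l (ltW (W_gt0 z0)) (r1 _ z0).
  by move: (W z) (W z * r z) => w v; lra.
- have [tW _] := lambert_Z_tame 4.
  apply: (tame_ext (f1 := fun x g => W (Z x g) + 2^-1 * (W (Z x g) * W (Z x g)))) => [x g|].
    by ring.
  by apply: tameD => //; apply/tameZ/tameM.
Qed.

End lambert_profile.

Lemma gsc_chi2 : generalized_self_concordant (6 / eps)
  (semi_dual_chi2 mu beta y c eps rho1 rho2).
Proof.
apply: gsc_lambertW.
  by rewrite mulr_gt0 ?expR_gt0 ?divr_gt0.
by rewrite divr_ge0 ?sqr_ge0 ?ltW.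
Qed.

End sources.

Theorem proposition7 (R : realType) (X : ptopologicalType) (Y : topologicalType)
  (hX : polish R X) (hY : polish R Y)
  (mu : {finite_measure set (borel X) -> \bar R})
  (n : nat) (hn : (0 < n)%N)
  (y : 'I_n -> Y) (beta : 'I_n -> R) (b B : R)
  (hb : 0 < b) (hbB : b <= B)
  (hbeta_gt0 : forall j : 'I_n, 0 < beta j)
  (hbeta : forall j : 'I_n, b / n%:R <= beta j <= B / n%:R)
  (c : X -> Y -> R)
  (hc_ge0 : forall (x : X) (z : Y), 0 <= c x z)
  (hc : continuous (fun p : X * Y => c p.1 p.2))
  (eps rho1 rho2 : R)
  (heps : 0 < eps) (hrho1 : 0 < rho1) (hrho2 : 0 < rho2) :
  generalized_self_concordant ((2 + 3 * alpha eps rho1) / eps)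
    (semi_dual_KL mu beta y c eps rho1 rho2) /\
  generalized_self_concordant (6 / eps)
    (semi_dual_chi2 mu beta y c eps rho1 rho2).
Proof.
have c_cont z : continuous (c ^~ z).
  move=> x.
  apply: (@continuous_comp _ _ _ (fun x' => (x', z)) (fun p : X * Y => c p.1 p.2)).
    by apply: cvg_pair => /=; [exact: cvg_id | exact: cvg_cst].
  exact: hc.
split.
  exact: (gsc_KL mu y hn hbeta_gt0 hc_ge0 c_cont heps hrho1 hrho2).
exact: (gsc_chi2 mu y hn hbeta_gt0 hc_ge0 c_cont heps hrho1 hrho2).
Qed.
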